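(* Let $1\le k\le n$, let $G$ be the affine Weyl group of type $\widetilde{A}_n$, and let $H_k\le G$ be the natural reflection subgroup of type $\widetilde{A}_{k-1}\times\widetilde{A}_{n-k}$, obtained by removing the $k$-th node from the Dynkin diagram of $A_n$. If $2k\neq n+1$, then $H_k$ is a proto-Gelfand subgroup of $G$. If $2k=n+1$, then $H_k$ has a double cover $K_k$ (that is, a subgroup $K_k$ with $H_k\le K_k\le G$ and $|K_k:H_k|=2$) which is a proto-Gelfand subgroup of $G$.
   Context: Gelfand pair: for a finite group $B$ and a subgroup $A\le B$, $(B,A)$ is a Gelfand pair if the permutation character $1_A^B$ (the complex trivial character of $A$ induced to $B$) is multiplicity-free. Proto-Gelfand subgroup: for a not necessarily finite group $B$ and $A\le B$, $A$ is a proto-Gelfand subgroup of $B$ if for every group homomorphism $\varphi:B\to B_1$ with finite image, $(\varphi(B),\varphi(A))$ is a Gelfand pair. The group $G$: let $\Phi$ be the root system of type $A_n$ with fundamental roots $\alpha_1,\dots,\alpha_n$ numbered consecutively along the Dynkin diagram (a path), and $W\cong S_{n+1}$ its Weyl group. With $\beta^\vee=\frac{2\beta}{(\beta,\beta)}$ and $L(\Phi^\vee)$ the $\mathbb{Z}$-span of the coroots, $G=W\ltimes L(\Phi^\vee)$, where $L(\Phi^\vee)$ acts by translations. For $\beta\in\Phi$, $m\in\mathbb{Z}$, the affine reflection $s_{\beta,m}$ is $v\mapsto v-((v,\beta)-m)\beta^\vee$. The subgroup $H_k$: let $\Phi_0$ be the root system generated by $\{\alpha_i\mid i\ne k\}$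 (of type $A_{k-1}\times A_{n-k}$). Then $H_k$ is the subgroup of $G$ generated by all $s_{\beta,m}$ with $\beta\in\Phi_0$, $m\in\mathbb{Z}$ (a factor of type $\widetilde{A}_0$ is trivial). *)

(* Defs.v *)
From HB Require Import structures.
From mathcomp Require Import all_boot all_order all_algebra all_fingroup.
From mathcomp Require Import all_solvable all_field all_character.
From mathcomp Require Import all_classical reals.

Set Implicit Arguments.
Unset Strict Implicit.
Unset Printing Implicit Defensive.

Import GRing.Theory Num.Theory.

Local Open Scope classical_set_scope.

(* Groups need not be finite: they are subsets of an ambient groupType. *)

Section Subgroups.
Local Open Scope group_scope.
Variable T : groupType.
Implicit Types A B X : set T.

Definition subgroup A : Prop :=
  [/\ A 1, forall x y, A x -> A y -> A (x * y) & forall x, A x -> A x^-1].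

Definition generated X : set T := smallest subgroup X.

Definition left_cosets B A : set (set T) := [set [set x * y | y in A] | x in B].

Definition has_index B A (d : nat) : Prop := (left_cosets B A #= `I_d)%card.

End Subgroups.

(* The permutation character 1_A^B is multiplicity-free.  MathComp characters
   take values in algC instead of the complex numbers, which does not affect
   multiplicities of irreducible constituents. *)
Definition perm_char_multiplicity_free (gT : finGroupType) (B A : {group gT}) :=
  forall i : Iirr B, ('['Ind[B] (1 : 'CF(A)), 'chi_i]_B <= 1)%R.

(* Character theory is only available inside a finGroupType, so the finite
   group B is transported there along an isomorphism. *)
Definition gelfand_pair (T : groupType) (B A : set T) : Prop :=
  exists (gT : finGroupType) (B' A' : {group gT}) (f : gT -> T),
    [/\ {in B' &, {morph f : x y / (x * y)%g}} /\ {in B' &, injective f},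
        f @` [set` B'] = B,
        f @` [set` A'] = A,
        A' \subset B'
      & perm_char_multiplicity_free B' A'].

(* Homomorphisms B -> B1 are the total functions that are multiplicative on B;
   their values outside B are irrelevant. *)
Definition proto_gelfand (T : groupType) (B A : set T) : Prop :=
  [/\ subgroup B, subgroup A, A `<=` B &
    forall (B1 : groupType) (phi : T -> B1),
      {in B &, {morph phi : x y / (x * y)%g}} ->
      finite_set (phi @` B) -> gelfand_pair (phi @` B) (phi @` A)].

(* The group of all self-bijections of a type, under composition
   ((f * g) v = f (g v)). *)

Section SelfBijections.
Variable V : Type.

Record selfbij := SelfBij {
  selfbij_fun :> V -> V;
  selfbij_inv : V -> V;
  selfbij_funK : cancel selfbij_fun selfbij_inv;
  selfbij_invK : cancel selfbij_inv selfbij_fun }.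

HB.instance Definition _ := gen_eqMixin selfbij.
HB.instance Definition _ := gen_choiceMixin selfbij.

Lemma selfbijP (f g : selfbij) : f =1 g -> f = g.
Proof.
case: f g => f f' fK f'K [g g' gK g'K] /= /funext fg.
have f'g' : f' = g' by apply/funext => v; rewrite -[in LHS](g'K v) -fg fK.
by subst; congr SelfBij; exact: Prop_irrelevance.
Qed.

Definition selfbij_one := @SelfBij id id (fun=> erefl) (fun=> erefl).

Definition selfbij_opp (f : selfbij) :=
  SelfBij (@selfbij_invK f) (@selfbij_funK f).

Definition selfbij_mul (f g : selfbij) :=
  SelfBij (can_comp (@selfbij_funK f) (@selfbij_funK g))
          (can_comp (@selfbij_invK g) (@selfbij_invK f)).

Lemma selfbij_mulA : associative selfbij_mul.
Proof. by move=> f g h; apply: selfbijP. Qed.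

Lemma selfbij_mul1 : left_id selfbij_one selfbij_mul.
Proof. by move=> f; apply: selfbijP. Qed.

Lemma selfbij_mulr1 : right_id selfbij_one selfbij_mul.
Proof. by move=> f; apply: selfbijP. Qed.

Lemma selfbij_mulV : left_inverse selfbij_one selfbij_opp selfbij_mul.
Proof. by move=> f; apply: selfbijP => v /=; rewrite selfbij_funK. Qed.

Lemma selfbij_mulrV : right_inverse selfbij_one selfbij_opp selfbij_mul.
Proof. by move=> f; apply: selfbijP => v /=; rewrite selfbij_invK. Qed.

HB.instance Definition _ := isGroup.Build selfbij
  selfbij_mulA selfbij_mul1 selfbij_mulr1 selfbij_mulV selfbij_mulrV.

End SelfBijections.

Section AffineWeylGroup.
Local Open Scope ring_scope.
Variables (R : realType) (n : nat).
Local Notation V := 'rV[R]_n.+1.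
Implicit Types (u v b t : V) (m : int).

Definition dotp u v : R := (u *m v^T) 0 0.

Definition coroot b : V := (2 / dotp b b) *: b.

Definition affine_reflection_fun b m v : V :=
  v - (dotp v b - m%:~R) *: coroot b.

(* For b = 0 the map is the identity (coroot 0 = 0), so no hypothesis on b is
   needed. *)
Lemma affine_reflectionK b m :
  cancel (affine_reflection_fun b m) (affine_reflection_fun b m).
Proof.
move=> v; rewrite /affine_reflection_fun.
have [->|b0] := eqVneq b 0; first by rewrite /coroot !scaler0 !subr0.
have bb0 : dotp b b != 0.
  apply: contra b0; rewrite /dotp mxE psumr_eq0 => [/allP bb|i _]; last first.
    by rewrite mxE -expr2 sqr_ge0.
  apply/eqP/rowP => i; have := bb i (mem_index_enum i).
  by rewrite !mxE mulf_eq0 orbb => /eqP.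
set c := dotp v b - m%:~R.
have -> : dotp (v - c *: coroot b) b = dotp v b - c * 2.
  have dB x y : dotp (x - y) b = dotp x b - dotp y b.
    by rewrite /dotp mulmxBl !mxE.
  have dZ a x : dotp (a *: x) b = a * dotp x b.
    by rewrite /dotp -scalemxAl !mxE.
  by rewrite dB !dZ divfK.
rewrite -addrA -opprD -scalerDl [dotp v b - c * 2 - _]addrAC -/c.
have -> : c + (c - c * 2) = 0 by rewrite mulr_natr mulr2n addrA subrr.
by rewrite scale0r subr0.
Qed.

Definition affine_reflection b m : selfbij V :=
  SelfBij (affine_reflectionK b m) (affine_reflectionK b m).

Definition translation t : selfbij V :=
  @SelfBij V (fun v => v + t) (fun v => v - t) (addrK t) (subrK t).

Definition basis_vec (i : nat) : V := delta_mx 0 (inord i).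

Definition roots_A : set V :=
  [set b | exists i j : 'I_n.+1, i != j /\ b = basis_vec i - basis_vec j].

(* Numbered 1 <= i <= n as on the Dynkin diagram. *)
Definition fundamental_root (i : nat) : V := basis_vec i.-1 - basis_vec i.

Definition reflection_closed (X : set V) : Prop :=
  forall b c, X b -> X c -> X (affine_reflection b 0 c).

Definition generated_root_system (S : set V) : set V :=
  smallest reflection_closed S.

Definition int_span_closed (X : set V) : Prop :=
  X 0 /\ forall u v, X u -> X v -> X (u - v).

Definition coroot_lattice : set V :=
  smallest int_span_closed (coroot @` roots_A).

Definition weyl_group : set (selfbij V) :=
  generated [set affine_reflection b 0 | b in roots_A].

(* The semidirect product of the Weyl group and the coroot lattice, realised
   as affine transformations v |-> w v + t of R^(n+1).  They preserve the
   span of the roots, on which the group acts faithfully. *)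
Definition affine_weyl_group : set (selfbij V) :=
  [set g | exists w t, [/\ weyl_group w, coroot_lattice t &
                           g = (translation t * w)%g]].

Definition roots_without (k : nat) : set V :=
  generated_root_system
    [set fundamental_root i | i in [set i | (1 <= i <= n)%N /\ i != k]].

Definition reflection_subgroup (k : nat) : set (selfbij V) :=
  generated [set g | exists b m, roots_without k b /\ g = affine_reflection b m].

End AffineWeylGroup.

Arguments affine_weyl_group R n _ : clear implicits.
Arguments reflection_subgroup R n k%_N _ : clear implicits.

(* Main.v *)
(* With N = n + 1, write the elements of the affine Weyl group as pairs (p, x) of
   a permutation p of the N coordinates and an integer translation x of sum 0.
   Put S = {0, ..., k - 1}; then H_k consists of the pairs with p S = S and
   sum_S x = 0.  If p S is neither S nor its complement, some root inside one
   block is moved by p to a root straddling the two blocks, so translations of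
   H_k change sum_S x freely, and the double coset of (p, x) depends only on
   #|S \cap p S|; in particular it is closed under inversion.  The other elements
   are those of K = {p S = S}, where H_k is the kernel of (p, x) |-> sum_S x, so
   that K / H_k is infinite cyclic, and, when 2k = N, those swapping the blocks.

   If 2k <> N, the double cosets outside K are closed under inversion and are also
   K-double cosets, and K / H_k is abelian; in every finite quotient this makes the
   Hecke algebra commutative.  If 2k = N, the normaliser quotient is infinite
   dihedral; adjoining a reflection of it to H_k makes all double cosets closed
   under inversion. *)

Require Import Defs.
From HB Require Import structures.
From mathcomp Require Import all_boot all_order all_algebra all_fingroup.
From mathcomp Require Import all_field all_character.
From mathcomp Require Import all_classical reals.
From mathcomp Require Import ring zify.

Set Implicit Arguments.
Unset Strict Implicit.
Unset Printing Implicit Defensive.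

Import GRing.Theory Num.Theory.

Local Open Scope classical_set_scope.

(** * Idempotent matrices and their corner algebras *)

Section Idempotent.
Local Open Scope ring_scope.
Variables (F : fieldType) (n : nat) (e : 'M[F]_n).
Hypothesis ee : e *m e = e.

(** Write [e = U *m V] with [U] of full column rank and [V] of full row rank. Idempotence reads
    [U *m (V *m U) *m V = U *m V], and both outer factors cancel. *)
Lemma row_col_base_idem : row_base e *m col_base e = 1%:M.
Proof.
apply: (row_free_inj (row_base_free e)); apply: (row_full_inj (col_base_full e)).
move: (col_base e) (row_base e) (mulmx_base e) => U V UV.
by rewrite mul1mx !mulmxA UV -mulmxA UV.
Qed.

Lemma mxtrace_idem : \tr e = (\rank e)%:R.
Proof.
by rewrite -[in LHS](mulmx_base e) mxtrace_mulC row_col_base_idem mxtrace1.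
Qed.

(** Since [V *m U = 1], the map [A |-> U *m A *m V] embeds the full matrix algebra of size [\rank e]
    into the corner algebra of [e], and that algebra is noncommutative from size 2 on. *)
Lemma rank_idem_le1 :
  (forall M N, (e *m M *m e) *m (e *m N *m e) = (e *m N *m e) *m (e *m M *m e)) ->
  (\rank e <= 1)%N.
Proof.
move=> comm_e; rewrite leqNgt; apply/negP => r_gt1.
have [fullU freeV] := (col_base_full e, row_base_free e).
move: (mulmx_base e) row_col_base_idem fullU freeV.
move: (col_base e) (row_base e) => U V UV VU fullU freeV.
have eU A : e *m (U *m A *m V) *m e = U *m A *m V.
  have <- : e *m U = U by rewrite -[RHS]mulmx1 -VU mulmxA UV.
  have <- : V *m e = V by rewrite -[RHS]mul1mx -VU -mulmxA UV.
  by rewrite !mulmxA ee -!(mulmxA _ e e) ee.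
have UV_comm (A B : 'M[F]_(\rank e)) : A *m B = B *m A.
  have := comm_e (U *m A *m V) (U *m B *m V); rewrite !eU !mulmxA.
  rewrite -!(mulmxA _ V U) VU !mulmx1 -!mulmxA => UAB.
  apply: (row_full_inj fullU); apply: (row_free_inj freeV).
  by rewrite -!mulmxA UAB.
(* The matrix units E_01 and E_10 have products E_00 and E_11, which differ at entry (1, 1). *)
have := UV_comm (delta_mx (Ordinal (ltnW r_gt1)) (Ordinal r_gt1))
                (delta_mx (Ordinal r_gt1) (Ordinal (ltnW r_gt1))).
rewrite !mul_delta_mx => /matrixP/(_ (Ordinal r_gt1) (Ordinal r_gt1)).
by rewrite !mxE /= => /eqP; rewrite eq_sym oner_eq0.
Qed.

End Idempotent.

(** * Averages over a subgroup in a representation *)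

Section SubgroupAverage.
Local Open Scope ring_scope.
Variables (gT : finGroupType) (G : {group gT}) (n : nat).
Variable rG : mx_representation algC G n.

(** For [X] inside [G], this is the projection onto the [X]-invariants of [rG]. *)
Definition avg_mx (X : {group gT}) : 'M[algC]_n :=
  #|X|%:R^-1 *: \sum_(x in X) rG x.

Section Average.
Variable X : {group gT}.
Hypothesis sXG : X \subset G.

Lemma avg_mxMr x : x \in X -> avg_mx X *m rG x = avg_mx X.
Proof.
move=> Xx; rewrite /avg_mx -scalemxAl mulmx_suml; congr (_ *: _).
rewrite [RHS](reindex_inj (mulIg x)) /=; apply: eq_big => y.
  by rewrite groupMr.
by move=> Xy; rewrite repr_mxM //; apply: (fintype.subsetP sXG).
Qed.

Lemma avg_mxMl x : x \in X -> rG x *m avg_mx X = avg_mx X.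
Proof.
move=> Xx; rewrite /avg_mx -scalemxAr mulmx_sumr; congr (_ *: _).
rewrite [RHS](reindex_inj (mulgI x)) /=; apply: eq_big => y.
  by rewrite groupMl.
by move=> Xy; rewrite repr_mxM //; apply: (fintype.subsetP sXG).
Qed.

(** Reduces absorption identities for averages to identities for single group elements. *)
Lemma avg_mx_sandwich m p (M : 'M[algC]_(m, n)) (N : 'M_(n, p)) P :
  (forall x, x \in X -> M *m rG x *m N = P) -> M *m avg_mx X *m N = P.
Proof.
move=> XP; rewrite /avg_mx -scalemxAr -scalemxAl mulmx_sumr mulmx_suml.
rewrite (eq_bigr _ XP) sumr_const -scaler_nat scalerA mulVf ?scale1r //.
by rewrite pnatr_eq0 -lt0n cardG_gt0.
Qed.

Lemma avg_mx_mulr (M : 'M[algC]_n) :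
  (forall x, x \in X -> rG x *m M = M) -> avg_mx X *m M = M.
Proof.
move=> XM; rewrite -[avg_mx X]mul1mx; apply: avg_mx_sandwich => x Xx.
by rewrite mul1mx XM.
Qed.

Lemma avg_mx_mull (M : 'M[algC]_n) :
  (forall x, x \in X -> M *m rG x = M) -> M *m avg_mx X = M.
Proof.
move=> XM; rewrite -[_ *m _]mulmx1; apply: avg_mx_sandwich => x Xx.
by rewrite mulmx1 XM.
Qed.

Lemma avg_mx_idem : avg_mx X *m avg_mx X = avg_mx X.
Proof. by apply: avg_mx_mulr => x; exact: avg_mxMl. Qed.

(** By Frobenius reciprocity both sides are the mean of the character of [rG] over [X]. With
    [mxtrace_idem], a multiplicity becomes the rank of a projection. *)
Lemma mxtrace_avg_mx : \tr (avg_mx X) = '[cfRepr rG, 'Ind[G] (1 : 'CF(X))].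
Proof.
rewrite -cfdot_Res_l cfdotE /avg_mx mxtraceZ raddf_sum /=; congr (_ * _).
apply: eq_bigr => x Xx; rewrite cfun1E Xx conjC1 mulr1 cfResE //.
by rewrite cfunE (fintype.subsetP sXG _ Xx).
Qed.

End Average.
End SubgroupAverage.

(** * A multiplicity-freeness criterion for finite groups *)

Section GelfandCriterion.
Local Open Scope group_scope.
Variables (gT : finGroupType) (G K A : {group gT}).
Hypotheses (sKG : K \subset G) (sAK : A \subset K).
(** This makes [A] normal in [K] with abelian quotient. *)
Hypothesis derKA : forall x y, x \in K -> y \in K -> (y * x)^-1 * (x * y) \in A.
Hypothesis invGK : forall g, g \in G -> g \notin K ->
  exists2 a, a \in A & exists2 b, b \in A & g^-1 = a * g * b.
Hypothesis mulKG : forall g k, g \in G -> g \notin K -> k \in K ->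
  exists2 a, a \in A & exists2 b, b \in A & k * g = a * g * b.

(* The matrices [e *m rG g *m e] represent the Hecke algebra of (G, A) on the
   A-invariants of rG, and for irreducible rG they span [e *m 'M_n *m e] by
   Burnside's theorem; so if they commute, the invariants have dimension <= 1. *)
Section Representation.
Variables (n : nat) (rG : mx_representation algC G n).
Local Open Scope ring_scope.
Let sAG : A \subset G := fintype.subset_trans sAK sKG.
Let e := avg_mx rG A.
Let f := avg_mx rG K.

Let e_double_coset a g b : a \in A -> g \in G -> b \in A ->
  e *m rG (a * g * b)%g *m e = e *m rG g *m e.
Proof.
move=> Aa Gg Ab.
have [Ga Gb] := (fintype.subsetP sAG _ Aa, fintype.subsetP sAG _ Ab).
rewrite !repr_mxM ?groupM // !mulmxA avg_mxMr //.
by rewrite -(mulmxA _ (rG b)) avg_mxMl.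
Qed.

Let f_double_coset a g b : a \in K -> g \in G -> b \in K ->
  f *m rG (a * g * b)%g *m f = f *m rG g *m f.
Proof.
move=> Ka Gg Kb.
have [Ga Gb] := (fintype.subsetP sKG _ Ka, fintype.subsetP sKG _ Kb).
rewrite !repr_mxM ?groupM // !mulmxA avg_mxMr //.
by rewrite -(mulmxA _ (rG b)) avg_mxMl.
Qed.

Let fe : f *m e = f.
Proof. by apply: avg_mx_mull => x /(fintype.subsetP sAK); exact: avg_mxMr. Qed.

Let ef : e *m f = f.
Proof. by apply: avg_mx_mulr => x /(fintype.subsetP sAK); exact: avg_mxMl. Qed.

Let eK_absorb g k : g \in G -> g \notin K -> k \in K ->
  e *m rG (k * g)%g *m e = e *m rG g *m e.
Proof.
by move=> Gg nKg /(mulKG Gg nKg)[a Aa [b Ab ->]]; rewrite e_double_coset.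
Qed.

Let e_inv g : g \in G -> g \notin K -> e *m rG g^-1%g *m e = e *m rG g *m e.
Proof.
by move=> Gg nKg; have [a Aa [b Ab ->]] := invGK Gg nKg; rewrite e_double_coset.
Qed.

(** Inversion, through [e_inv], turns left absorption into right absorption. *)
Let eK_absorbr g k : g \in G -> g \notin K -> k \in K ->
  e *m rG (g * k)%g *m e = e *m rG g *m e.
Proof.
move=> Gg nKg Kk; have Gk := fintype.subsetP sKG _ Kk.
rewrite -e_inv; [|exact: groupM|by rewrite groupMr].
by rewrite invMg eK_absorb ?groupV // e_inv.
Qed.

Let f_inv g : g \in G -> f *m rG g^-1%g *m f = f *m rG g *m f.
Proof.
move=> Gg; have [Kg|nKg] := boolP (g \in K).
  by rewrite !avg_mxMr ?groupV.
have [a Aa [b Ab ->]] := invGK Gg nKg.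
by rewrite f_double_coset //; exact: (fintype.subsetP sAK).
Qed.

(** Outside [K] the double cosets of [A] and of [K] coincide, so averaging over either subgroup
    gives the same matrix. *)
Let e_eq_f g : g \in G -> g \notin K -> e *m rG g *m e = f *m rG g *m f.
Proof.
move=> Gg nKg; have -> : f *m rG g *m f = e *m f *m (rG g *m f *m e).
  by rewrite ef -(mulmxA _ f e) fe mulmxA.
(* Both inner factors [f] are expanded as averages over [K]; every term [e *m rG (k * g * l) *m e]
   is then absorbed. *)
symmetry; apply: avg_mx_sandwich => k Kk; rewrite !mulmxA.
apply: avg_mx_sandwich => l Kl.
have [Gk Gl] := (fintype.subsetP sKG _ Kk, fintype.subsetP sKG _ Kl).
rewrite -(mulmxA e (rG k)) -repr_mxM // -(mulmxA e (rG (k * g)%g)).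
rewrite -repr_mxM ?groupM // -mulgA.
rewrite eK_absorb ?eK_absorbr //; first exact: groupM.
by rewrite groupMr.
Qed.

(** Gelfand's trick: inversion reverses products, yet by [f_inv] it fixes every [f *m rG g *m f]. *)
Let f_comm g h : g \in G -> h \in G ->
  (f *m rG g *m f) *m (f *m rG h *m f) = (f *m rG h *m f) *m (f *m rG g *m f).
Proof.
have prodE x y : x \in G -> y \in G -> (f *m rG x *m f) *m (f *m rG y *m f)
    = #|K|%:R^-1 *: \sum_(k in K) f *m rG (x * k * y)%g *m f.
  move=> Gx Gy; rewrite !mulmxA -(mulmxA _ f f) avg_mx_idem // -(mulmxA _ (rG y)).
  rewrite {2}/f /avg_mx -scalemxAr -scalemxAl; congr (_ *: _).
  rewrite mulmx_sumr mulmx_suml; apply: eq_bigr => k Kk.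
  have Gk := fintype.subsetP sKG _ Kk.
  by rewrite !repr_mxM ?groupM // !mulmxA.
move=> Gg Gh; rewrite -[in RHS](f_inv Gg) -[in RHS](f_inv Gh) !prodE ?groupV //.
congr (_ *: _); rewrite (reindex_inj invg_inj) /=.
apply: eq_big => [k|k Kk]; first exact: groupV.
have Gk : k \in G by rewrite -groupV (fintype.subsetP sKG).
by rewrite -f_inv ?groupM ?groupV // !invMg !invgK mulgA.
Qed.

Let conj_mem a k : a \in A -> k \in K -> (k * a * k^-1)%g \in A.
Proof.
move=> Aa Kk; have Ka := fintype.subsetP sAK _ Aa.
(* This instance of [derKA] is the commutator [k * a * k^-1 * a^-1]. *)
have := derKA (groupVr Kk) (groupVr Ka).
by rewrite invMg !invgK !mulgA groupMr ?groupV.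
Qed.

Let e_normal k : k \in K -> e *m rG k *m e = e *m rG k.
Proof.
move=> Kk; have Gk := fintype.subsetP sKG _ Kk.
apply: avg_mx_mull => a Aa; have Ga := fintype.subsetP sAG _ Aa.
rewrite -mulmxA -repr_mxM // -(mulgKV k (k * a)%g) repr_mxM ?groupM ?groupV //.
by rewrite mulmxA avg_mxMr ?conj_mem.
Qed.

(** Three cases: if [g] and [h] both lie outside [K], [e] may be replaced by [f]; if just one lies
    in [K], it is absorbed on either side; if both do, [K / A] is abelian. *)
Let e_comm g h : g \in G -> h \in G ->
  (e *m rG g *m e) *m (e *m rG h *m e) = (e *m rG h *m e) *m (e *m rG g *m e).
Proof.
have mulKx x y : x \in K -> y \in G ->
    (e *m rG x *m e) *m (e *m rG y *m e) = e *m rG (x * y)%g *m e.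
  move=> Kx Gy; have Gx := fintype.subsetP sKG _ Kx.
  rewrite !mulmxA -(mulmxA _ e e) avg_mx_idem // -/e (e_normal Kx).
  by rewrite repr_mxM // mulmxA.
have mulxK x y : x \in G -> y \in K ->
    (e *m rG x *m e) *m (e *m rG y *m e) = e *m rG (x * y)%g *m e.
  move=> Gx Ky; have Gy := fintype.subsetP sKG _ Ky.
  have ye : e *m (rG y *m e) = rG y *m e.
    apply: avg_mx_mulr => a Aa; have Ga := fintype.subsetP sAG _ Aa.
    rewrite mulmxA -repr_mxM // -(mulKVg y (a * y)%g) repr_mxM ?groupM ?groupV //.
    rewrite -mulmxA avg_mxMl // mulgA.
    by have := conj_mem Aa (groupVr Ky); rewrite invgK.
  by rewrite -!mulmxA !ye repr_mxM // !mulmxA.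
move=> Gg Gh; have [Kg|nKg] := boolP (g \in K); last first.
  have [Kh|nKh] := boolP (h \in K); last by rewrite !e_eq_f // f_comm.
  rewrite (mulKx h g) // (mulxK g h) //.
  by rewrite (eK_absorb Gg nKg Kh) (eK_absorbr Gg nKg Kh).
rewrite (mulKx g h) // (mulxK h g) //.
have [Kh|nKh] := boolP (h \in K); last first.
  by rewrite (eK_absorb Gh nKh Kg) (eK_absorbr Gh nKh Kg).
rewrite -(mulKVg (h * g)%g (g * h)%g) -[((h * g) * _)%g]mul1g mulgA.
by rewrite e_double_coset //; [exact: groupM | exact: derKA].
Qed.

Lemma invariants_le1 :
  mx_irreducible rG -> '[cfRepr rG, 'Ind[G] (1 : 'CF(A))] <= 1.
Proof.
(* Over [algC] irreducibility is absolute, so [c] expands every matrix in the [rG g]. *)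
move=> /groupC/mx_abs_irrP[_ [c cE]].
rewrite -mxtrace_avg_mx // mxtrace_idem ?avg_mx_idem // (ler_nat _ _ 1).
apply: rank_idem_le1; first exact: avg_mx_idem.
(* Commutation extends linearly in one argument at a time; this is applied once for each
   argument. *)
have commr (E M : 'M[algC]_n) :
    (forall g, g \in G ->
       (E *m rG g *m E) *m (E *m M *m E) = (E *m M *m E) *m (E *m rG g *m E)) ->
    forall N, (E *m N *m E) *m (E *m M *m E) = (E *m M *m E) *m (E *m N *m E).
  move=> comm_M N; rewrite [N]cE !(mulmx_sumr, mulmx_suml).
  apply: eq_bigr => g Gg.
  rewrite -!scalemxAr -!scalemxAl -!scalemxAr; congr (_ *: _); exact: comm_M.
move=> M N; apply: (commr e) => g Gg; symmetry; apply: (commr e) => h Gh.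
exact: e_comm.
Qed.

End Representation.

Lemma perm_char_multiplicity_free_criterion : perm_char_multiplicity_free G A.
Proof.
move=> i; rewrite cfdotC_char ?irr_char ?cfInd_char ?cfun1_char // -irrRepr.
exact: invariants_le1 (socle_irr (socle_of_Iirr i)).
Qed.

End GelfandCriterion.

(** * Transport of finite subgroups to finite group types *)

Section FiniteSubgroups.
Local Open Scope group_scope.
Variable T : groupType.
Implicit Types S X A K B : set T.

Lemma finite_subgroup_model S : subgroup S -> finite_set S ->
  exists (gT : finGroupType) (f : gT -> T),
    [/\ {morph f : x y / x * y}, injective f & range f = S].
Proof.
move=> [S1 SM SV] /finite_seqP[s Ss].
have sS x : x \in s = S x :> Prop by rewrite Ss.
have s1 : 1 \in s by rewrite sS.
have sM (x y : seq_sub s) : val x * val y \in s.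
  by rewrite sS; apply: SM; rewrite -sS; exact: ssvalP.
have sV (x : seq_sub s) : (val x)^-1 \in s.
  by rewrite sS; apply: SV; rewrite -sS; exact: ssvalP.
pose mul x y : seq_sub s := SeqSub (sM x y).
pose inv x : seq_sub s := SeqSub (sV x).
have mulA : associative mul by move=> x y z; apply: val_inj; rewrite /= mulgA.
have mul1 : left_id (SeqSub s1) mul by move=> x; apply: val_inj; rewrite /= mul1g.
have mulV : left_inverse (SeqSub s1) inv mul.
  by move=> x; apply: val_inj; rewrite /= mulVg.
pose grp := Finite_isGroup.Build (seq_sub s) mulA mul1 mulV.
pose gT : finGroupType := HB.pack (seq_sub s) grp.
exists gT, (fun x : seq_sub s => val x).
split; [by [] | exact: (@val_inj _ _ (seq_sub s)) |].
apply/seteqP; split=> [_ [x _ <-]|x]; first by rewrite -sS; exact: ssvalP.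
by rewrite -sS => xs; exists (SeqSub xs).
Qed.

(** [K] and [A] are pulled back along an isomorphism [f] from a finite group type onto [B].
    Injectivity of [f] lets the equations descend, and [liftA] lifts their witnesses. *)
Lemma gelfand_pair_criterion B K A :
    subgroup B -> subgroup K -> subgroup A -> A `<=` K -> K `<=` B ->
    finite_set B ->
    (forall x y, K x -> K y -> A ((y * x)^-1 * (x * y))) ->
    (forall g, B g -> ~ K g ->
       exists a b, [/\ A a, A b & g^-1 = a * g * b]) ->
    (forall g k, B g -> ~ K g -> K k ->
       exists a b, [/\ A a, A b & k * g = a * g * b]) ->
  gelfand_pair B A.
Proof.
move=> sB sK sA AK KB finB derKA invBK mulKB.
have [gT [f [fM f_inj fB]]] := finite_subgroup_model sB finB.
have f1 : f 1 = 1 by apply: (mulgI (f 1)); rewrite -fM !mulg1.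
have fV x : f x^-1 = (f x)^-1 by apply: (mulgI (f x)); rewrite -fM !mulgV.
have pre_group X : subgroup X -> group_set [set x | f x \in X].
  move=> [X1 XM XV]; apply/group_setP; split=> [|x y].
    by rewrite !inE f1.
  by rewrite !inE fM; exact: XM.
pose pre X sX := Group (pre_group X sX).
have mem_pre X sX x : x \in pre X sX = X (f x) :> Prop.
  by rewrite !inE.
have pre_im X sX : X `<=` B -> f @` [set` pre X sX] = X.
  move=> XB; apply/seteqP; split=> [_ [x /= Xx <-]|x Xx].
    by rewrite mem_pre in Xx.
  have := XB _ Xx; rewrite -fB => -[y _ yx]; exists y => //=.
  by rewrite (mem_pre X sX) yx.
have liftA a : A a -> exists2 a', a' \in pre A sA & f a' = a.
  rewrite -{1}(pre_im A sA) => [[a' ? <-]|]; first by exists a'.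
  exact: subset_trans KB.
exists gT, (pre B sB), (pre A sA), f; split.
- by split=> x y _ _; [exact: fM | exact: f_inj].
- exact: pre_im.
- by apply: pre_im; exact: subset_trans KB.
- by apply/fintype.subsetP => x; rewrite !mem_pre => /AK/KB.
apply: (@perm_char_multiplicity_free_criterion _ _ (pre K sK)).
- by apply/fintype.subsetP => x; rewrite !mem_pre => /KB.
- by apply/fintype.subsetP => x; rewrite !mem_pre => /AK.
- by move=> x y; rewrite !mem_pre !(fM, fV); exact: derKA.
- move=> g; rewrite !mem_pre => Bg Kg.
  have nKg : ~ K (f g) by rewrite -(mem_pre K sK); exact/negP.
  have [_ [_ [/liftA[a Aa <-] /liftA[b Ab <-] eq_g]]] := invBK _ Bg nKg.
  by exists a => //; exists b => //; apply: f_inj; rewrite fV eq_g !fM.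
move=> g k; rewrite !mem_pre => Bg Kg Kk.
have nKg : ~ K (f g) by rewrite -(mem_pre K sK); exact/negP.
have [_ [_ [/liftA[a Aa <-] /liftA[b Ab <-] eq_g]]] := mulKB _ _ Bg nKg Kk.
by exists a => //; exists b => //; apply: f_inj; rewrite fM eq_g !fM.
Qed.

End FiniteSubgroups.

(** * From an infinite group to its finite images *)

Section ProtoGelfand.
Local Open Scope group_scope.

(** The conditions are equations in [B] with witnesses in [A], so they survive [phi]; an element
    with image outside the image of [K] is itself outside [K]. *)
Lemma proto_gelfand_criterion (T : groupType) (B K A : set T) :
    subgroup B -> subgroup K -> subgroup A -> A `<=` K -> K `<=` B ->
    (forall x y, K x -> K y -> A ((y * x)^-1 * (x * y))) ->
    (forall g, B g -> ~ K g ->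
       exists a b, [/\ A a, A b & g^-1 = a * g * b]) ->
    (forall g k, B g -> ~ K g -> K k ->
       exists a b, [/\ A a, A b & k * g = a * g * b]) ->
  proto_gelfand B A.
Proof.
move=> sB sK sA AK KB derKA invBK mulKB; split=> //; first exact: subset_trans KB.
move=> B1 phi phiM finB.
have {}phiM x y : B x -> B y -> phi (x * y) = phi x * phi y.
  by move=> Bx By; apply: phiM; exact: mem_set.
have AB x : A x -> B x by move=> /AK/KB.
have [B_1 BM BV] := sB.
have phi1 : phi 1 = 1 by apply: (mulgI (phi 1)); rewrite -phiM // !mulg1.
have phiV x : B x -> phi x^-1 = (phi x)^-1.
  by move=> Bx; apply: (mulgI (phi x)); rewrite -phiM ?mulgV //; exact: BV.
have sub_im X : subgroup X -> X `<=` B -> subgroup (phi @` X).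
  move=> [X1 XM XV] XB; split; first by exists 1.
  - move=> _ _ [x Xx <-] [y Xy <-]; exists (x * y); first exact: XM.
    by rewrite phiM //; exact: XB.
  - by move=> _ [x Xx <-]; exists x^-1; [exact: XV | rewrite phiV //; exact: XB].
apply: (@gelfand_pair_criterion _ _ (phi @` K)) => //.
- exact: sub_im.
- exact: sub_im.
- exact: sub_im.
- exact: image_subset.
- exact: image_subset.
- move=> _ _ [x Kx <-] [y Ky <-]; exists ((y * x)^-1 * (x * y)); first exact: derKA.
  have [Bx By] := (KB _ Kx, KB _ Ky).
  by rewrite phiM ?phiV ?phiM //; do ?[exact: BM | apply: BV].
- move=> _ [g Bg <-] nKg; have nKg' : ~ K g by move=> Kg; apply: nKg; exists g.
  have [a [b [Aa Ab eq_g]]] := invBK _ Bg nKg'; exists (phi a), (phi b).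
  split; [by exists a | by exists b |].
  rewrite -phiV // eq_g !phiM //; do ?[exact: AB].
  by apply: BM => //; exact: AB.
- move=> _ _ [g Bg <-] nKg [k Kk <-].
  have nKg' : ~ K g by move=> Kg; apply: nKg; exists g.
  have [a [b [Aa Ab eq_g]]] := mulKB _ _ Bg nKg' Kk; exists (phi a), (phi b).
  split; [by exists a | by exists b |].
  rewrite -phiM // ?eq_g ?phiM //; do ?[exact: AB | exact: KB].
  by apply: BM => //; exact: AB.
Qed.

End ProtoGelfand.

Lemma sum_delta (J : finType) (P : pred J) (c : J) :
  (\sum_(i | P i) (i == c)%:R = (P c)%:R :> int)%R.
Proof.
case: (boolP (P c)) => [Pc|/negP nPc].
  by rewrite (bigD1 c) //= eqxx big1 ?addr0 // => i /andP[_ /negPf ->].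
by rewrite big1 // => i Pi; case: eqP Pi => // ->.
Qed.

Lemma subgroup_generated (T : groupType) (X : set T) : subgroup (Defs.generated X).
Proof.
split; first by move=> A [[A1 _ _] _].
- move=> x y Xx Xy A sXA; have [[_ AM _] _] := sXA.
  by apply: AM; [exact: Xx | exact: Xy].
- move=> x Xx A sXA; have [[_ _ AV] _] := sXA.
  by apply: AV; exact: Xx.
Qed.

(** * Affine permutations of the coordinates *)

Section AffinePermutations.
Local Open Scope ring_scope.
Variables (R : realType) (n : nat).
Local Notation V := 'rV[R]_n.+1.
Local Notation I := 'I_n.+1.
Implicit Types (g h : selfbij V) (p q : 'S_n.+1) (x y : I -> int) (i j : I).

(* MathComp permutations compose left to right, (p * q) i = q (p i), and selfbij
   composes right to left, so that g |-> p is a morphism. *)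
Definition acts_as g p x := forall v i, g v 0 i = v 0 (p i) + (x i)%:~R.

Lemma acts_as_one : acts_as 1%g 1%g (fun=> 0).
Proof. by move=> v i; rewrite perm1 addr0. Qed.

Lemma acts_as_mul g h p q x y : acts_as g p x -> acts_as h q y ->
  acts_as (g * h)%g (p * q)%g (fun i => x i + y (p i)).
Proof.
by move=> gp hq v i; rewrite [LHS]gp hq permM rmorphD /= -addrA [_%:~R + _]addrC.
Qed.

Lemma acts_as_inv g p x : acts_as g p x ->
  acts_as g^-1%g p^-1%g (fun i => - x (p^-1%g i)).
Proof.
move=> gp v i; rewrite rmorphN /= -[in RHS](selfbij_invK g v) gp permKV.
by rewrite addrK.
Qed.

Lemma acts_as_inj g h p x y : acts_as g p x -> acts_as h p y -> x =1 y -> g = h.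
Proof.
by move=> gp hp xy; apply: selfbijP => v; apply/rowP => i; rewrite gp hp xy.
Qed.

Lemma acts_as_ext g p q x y : acts_as g p x -> p = q -> x =1 y -> acts_as g q y.
Proof. by move=> gp <- xy v i; rewrite gp xy. Qed.

Lemma acts_as_perm_unique g p q x y : acts_as g p x -> acts_as g q y -> p = q.
Proof.
move=> gp gq; apply/permP => i.
(* Evaluation at 0 recovers the translation; evaluation at a basis vector then recovers the
   permutation. *)
have xy : x i = y i.
  by apply: (@intr_inj R); have := gp 0 i; rewrite gq !mxE !add0r.
have := gp (delta_mx 0 (p i)) i; rewrite gq xy => /addIr.
rewrite !mxE !eqxx /=; case: eqP => // _ /eqP.
by rewrite eq_sym oner_eq0.
Qed.

Lemma affine_perm_funK p x :
  cancel (fun v : V => \row_i (v 0 (p i) + (x i)%:~R))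
         (fun v : V => \row_i (v 0 (p^-1%g i) - (x (p^-1%g i))%:~R)).
Proof. by move=> v; apply/rowP => i; rewrite !mxE permKV addrK. Qed.

Lemma affine_perm_invK p x :
  cancel (fun v : V => \row_i (v 0 (p^-1%g i) - (x (p^-1%g i))%:~R))
         (fun v : V => \row_i (v 0 (p i) + (x i)%:~R)).
Proof. by move=> v; apply/rowP => i; rewrite !mxE permK subrK. Qed.

Definition affine_perm p x : selfbij V :=
  SelfBij (affine_perm_funK p x) (affine_perm_invK p x).

Lemma acts_as_affine_perm p x : acts_as (affine_perm p x) p x.
Proof. by move=> v i; rewrite mxE. Qed.

Lemma acts_as_translation x :
  acts_as (translation (\row_i (x i)%:~R)) 1%g x.
Proof. by move=> v i; rewrite /= !mxE perm1. Qed.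

Local Notation e i := (basis_vec R n i).

Lemma basis_vecE i j : e i 0 j = (j == i)%:R.
Proof. by rewrite /basis_vec mxE inord_val. Qed.

Lemma dotp_root v i j : dotp v (e i - e j) = v 0 i - v 0 j.
Proof.
rewrite /dotp linearB /= mulmxBr !mxE; congr (_ - _).
  rewrite (bigD1 i) //= mxE basis_vecE eqxx mulr1 big1 ?addr0 // => a ai.
  by rewrite mxE basis_vecE (negPf ai) mulr0.
rewrite (bigD1 j) //= mxE basis_vecE eqxx mulr1 big1 ?addr0 // => a ai.
by rewrite mxE basis_vecE (negPf ai) mulr0.
Qed.

Lemma coroot_root i j : i != j -> coroot (e i - e j) = e i - e j.
Proof.
move=> ij; rewrite /coroot dotp_root !mxE !inord_val !eqxx /=.
rewrite [j == i]eq_sym (negPf ij).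
by rewrite subr0 sub0r opprK divff ?scale1r // pnatr_eq0.
Qed.

Lemma acts_as_reflection i j (m : int) : i != j ->
  acts_as (affine_reflection (e i - e j) m) (tperm i j)
          (fun a => m * ((a == i)%:R - (a == j)%:R)).
Proof.
move=> ij v a; rewrite /= /affine_reflection_fun coroot_root // dotp_root.
rewrite !mxE !inord_val /= rmorphM rmorphB /= !rmorph_nat.
have [->|ai] := eqVneq a i; first by rewrite tpermL (negPf ij) /=; ring.
have [->|aj] := eqVneq a j; first by rewrite tpermR /=; ring.
by rewrite tpermD 1?eq_sym //=; ring.
Qed.

Lemma reflection_root i j (a b : I) : i != j ->
  affine_reflection (e i - e j) 0 (e a - e b)
  = e (tperm i j a) - e (tperm i j b).
Proof.
move=> ij; apply/rowP => c; rewrite (acts_as_reflection 0 ij) mul0r addr0.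
rewrite !mxE !inord_val; congr (_%:R - _%:R);
  by rewrite -(inj_eq (@perm_inj _ (tperm i j))) tpermK.
Qed.

(* A partition of the coordinates into blocks is given by an idempotent r
   choosing a representative of each block. *)
Section Blocks.
Variable r : I -> I.
Hypothesis rK : forall i, r (r i) = r i.

(** Induction on the number of moved points: following [p] by the transposition of [i] and [p i],
    which lie in one block, makes [i] fixed and unfixes nothing. *)
Lemma perm_generation (X : set (selfbij V)) p g : subgroup X ->
    (forall i j, i != j -> r i = r j -> X (affine_reflection (e i - e j) 0)) ->
  (forall i, r (p i) = r i) -> acts_as g p (fun=> 0) -> X g.
Proof.
move=> [X1 XM _] Xrefl; have [m] := ubnP #|[set i | p i != i]|%SET.
elim: m => // m IHm in p g *; rewrite ltnS => p_m rp gp.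
have [p_fix|] := pselect (forall i, p i = i).
  suff -> : g = 1%g by [].
  by apply: (acts_as_inj gp) => // v i; rewrite p_fix addr0.
move=> /existsNP[i /eqP pi_neq]; pose t := tperm i (p i).
have i_neq : i != p i by rewrite eq_sym.
have rt j : r (t j) = r j by rewrite /t; case: tpermP => // ->; rewrite rp.
have tp : (p * t * t)%g = p by rewrite -mulgA tperm2 mulg1.
have gt := acts_as_reflection 0 i_neq.
have ght := acts_as_mul (acts_as_affine_perm (p * t)%g (fun=> 0)) gt.
have -> : g = (affine_perm (p * t)%g (fun=> 0) *
               affine_reflection (e i - e (p i)) 0)%g.
  apply: acts_as_inj gp (acts_as_ext ght tp (frefl _)) _ => j.
  by rewrite mul0r addr0.
apply: XM; last by apply: Xrefl; rewrite ?rp.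
apply: IHm (acts_as_affine_perm _ _) => [|j]; last by rewrite permM rt rp.
apply: leq_trans p_m; apply: proper_card; apply/properP; split.
  apply/fintype.subsetP => j; rewrite !finset.inE permM; apply: contraNneq => pj.
  rewrite pj tpermD //; first by apply: contraNneq pi_neq => ->; rewrite pj.
  apply: contraNneq pi_neq => pij; apply/eqP/(@perm_inj _ p).
  by rewrite pij pj.
by exists i; rewrite !finset.inE // permM tpermR eqxx.
Qed.

Lemma int_span_closed_sum (X : set V) (F : I -> V) (c : I -> int) :
  int_span_closed X -> (forall j, X (F j)) -> X (\sum_j F j *~ c j).
Proof.
move=> [X0 XB] XF; have XN u : X u -> X (- u) by rewrite -sub0r; exact: XB.
have XD u v : X u -> X v -> X (u + v).
  by move=> Xu Xv; rewrite -[v]opprK; apply: XB => //; exact: XN.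
have XMn u m : X u -> X (u *+ m).
  by move=> Xu; elim: m => [|m IHm]; rewrite ?mulr0n // mulrS; exact: XD.
elim/big_ind : _ => // j _; case: (c j) => m; first exact: XMn.
by rewrite NegzE mulrNz; apply: XN; exact: XMn.
Qed.

(** The vector is the sum of the [x i] multiples of [e i - e (r i)]: the terms in [e (r i)] collect
    the block sums of [x], which vanish. *)
Lemma lattice_generation (X : set V) x : int_span_closed X ->
    (forall i j, i != j -> r i = r j -> X (e i - e j)) ->
    (forall j, \sum_(i | r i == j) x i = 0) ->
  X (\row_i (x i)%:~R).
Proof.
move=> clX Xroot x0.
have -> : \row_i (x i)%:~R = \sum_(i : I) (e i - e (r i)) *~ x i :> V.
  apply/rowP => a; rewrite mxE summxE.
  transitivity (((\sum_i (a == i)%:R * x i)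
                 - \sum_i (a == r i)%:R * x i)%:~R : R).
    congr _%:~R; rewrite (bigD1 a) //= eqxx mul1r big1 ?addr0; last first.
      by move=> i ia; rewrite eq_sym (negPf ia) mul0r.
    rewrite -[LHS]subr0; congr (_ - _); rewrite -[LHS](x0 a) big_mkcond /=.
    apply: eq_bigr => i _; rewrite [a == _]eq_sym.
    by case: eqP; rewrite ?mul1r ?mul0r.
  rewrite -sumrB rmorph_sum /=; apply: eq_bigr => i _.
  rewrite -scaler_int !mxE !inord_val /= rmorphB !rmorphM /= !rmorph_nat.
  by rewrite -mulrBl mulrC.
apply: int_span_closed_sum => // i.
have [->|i_neq] := eqVneq (r i) i; first by rewrite subrr; case: clX.
by apply: Xroot; rewrite ?rK // eq_sym.
Qed.

(** A constant [r] gives the affine Weyl group, and [block_rep k] gives H_k. *)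
Definition block_affine_group : set (selfbij V) :=
  [set g | exists p x, [/\ acts_as g p x, forall i, r (p i) = r i &
                           forall j, \sum_(i | r i == j) x i = 0]].

Lemma block_sum_perm p x j : (forall i, r (p i) = r i) ->
  \sum_(i | r i == j) x (p i) = \sum_(i | r i == j) x i.
Proof.
move=> rp; rewrite [RHS](reindex_inj (@perm_inj _ p)) /=.
by apply: eq_bigl => i; rewrite rp.
Qed.

Lemma subgroup_block_affine_group : subgroup block_affine_group.
Proof.
split.
- exists 1%g, (fun=> 0); split; first exact: acts_as_one.
    by move=> i; rewrite perm1.
  by move=> j; rewrite big1.
- move=> g h [p [x [gp rp x0]]] [q [y [hq rq y0]]].
  exists (p * q)%g, (fun i => x i + y (p i)); split; first exact: acts_as_mul.
    by move=> i; rewrite permM rq rp.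
  by move=> j; rewrite big_split /= block_sum_perm // x0 y0.
- move=> g [p [x [gp rp x0]]].
  have rpV i : r (p^-1%g i) = r i by rewrite -[in RHS](permKV p i) rp.
  exists p^-1%g, (fun i => - x (p^-1%g i)); split=> //; first exact: acts_as_inv.
  by move=> j; rewrite sumrN block_sum_perm // x0 oppr0.
Qed.

Lemma reflection_block_affine_group i j m : i != j -> r i = r j ->
  block_affine_group (affine_reflection (e i - e j) m).
Proof.
move=> ij rij; exists (tperm i j), (fun a => m * ((a == i)%:R - (a == j)%:R)).
split=> [|a|a]; first exact: acts_as_reflection.
  by case: tpermP => // ->.
by rewrite -mulr_sumr sumrB !sum_delta rij subrr mulr0.
Qed.

End Blocks.

Lemma block_affine_group_generated (r : I -> I) (X : set (selfbij V)) :
    (forall i, r (r i) = r i) -> subgroup X ->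
    (forall i j m, i != j -> r i = r j -> X (affine_reflection (e i - e j) m)) ->
  block_affine_group r `<=` X.
Proof.
move=> rK sX Xrefl g [p [x [gp rp x0]]]; have [X1 XM XV] := sX.
have -> : g = (translation (\row_i (x i)%:~R) * affine_perm p (fun=> 0))%g.
  apply: acts_as_inj gp (acts_as_ext (acts_as_mul (acts_as_translation x)
           (acts_as_affine_perm p (fun=> 0))) (mul1g _) (frefl _)) _ => i.
  by rewrite addr0.
apply: (XM); last first.
  apply: (@perm_generation r X p) => // [i j|]; first exact: Xrefl.
  exact: acts_as_affine_perm.
apply: (@lattice_generation r rK [set t | X (translation t)]) => // [|i j ij rij].
  split=> [|u v Xu Xv] /=.
    suff -> : translation 0 = 1%g :> selfbij V by [].
    by apply: selfbijP => v; rewrite /= addr0.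
  suff -> : translation (u - v) = (translation u * (translation v)^-1)%g.
    by apply: (XM) => //; exact: XV.
  by apply: selfbijP => w /=; rewrite addrA addrAC.
(* Reflections in two parallel hyperplanes compose to a translation by the coroot. *)
rewrite /mkset; suff -> : translation (e i - e j) =
    (affine_reflection (e i - e j) 1 * affine_reflection (e i - e j) 0)%g.
  by apply: XM; exact: Xrefl.
apply: selfbijP => v; apply/rowP => a.
rewrite (acts_as_mul (acts_as_reflection 1 ij) (acts_as_reflection 0 ij)).
by rewrite tperm2 perm1 mul0r addr0 mul1r !mxE !inord_val rmorphB /= !rmorph_nat.
Qed.

Definition linear_perm_group : set (selfbij V) :=
  [set g | exists p, acts_as g p (fun=> 0)].

Lemma subgroup_linear_perm_group : subgroup linear_perm_group.
Proof.
split.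
- by exists 1%g; exact: acts_as_one.
- move=> g h [p gp] [q hq]; exists (p * q)%g.
  by apply: acts_as_ext (acts_as_mul gp hq) (erefl _) _ => i; rewrite addr0.
- move=> g [p gp]; exists p^-1%g.
  by apply: acts_as_ext (acts_as_inv gp) (erefl _) _ => i; rewrite oppr0.
Qed.

Lemma weyl_group_linear : @weyl_group R n `<=` linear_perm_group.
Proof.
apply: smallest_sub; first exact: subgroup_linear_perm_group.
move=> _ [_ [i [j [ij ->]]] <-]; exists (tperm i j).
by apply: acts_as_ext (acts_as_reflection 0 ij) (erefl _) _ => a; rewrite mul0r.
Qed.

Lemma coroot_lattice_sum0 (t : V) : coroot_lattice t ->
  exists2 x : I -> int, t = \row_i (x i)%:~R & \sum_i x i = 0.
Proof.
pose X := [set t : V |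
  exists2 x : I -> int, t = \row_i (x i)%:~R & \sum_i x i = 0].
suff : @coroot_lattice R n `<=` X by exact.
apply: smallest_sub.
  split; first by exists (fun=> 0); [apply/rowP => i; rewrite !mxE | rewrite big1].
  move=> _ _ [x -> x0] [y -> y0]; exists (fun i => x i - y i).
    by apply/rowP => i; rewrite !mxE rmorphB.
  by rewrite sumrB x0 y0 subrr.
move=> _ [_ [i [j [ij ->]]] <-]; rewrite coroot_root //.
exists (fun a => (a == i)%:R - (a == j)%:R).
  by apply/rowP => a; rewrite !mxE !inord_val rmorphB /= !rmorph_nat.
by rewrite sumrB !sum_delta subrr.
Qed.

Lemma affine_weyl_groupE : affine_weyl_group R n = block_affine_group (fun=> ord0).
Proof.
(* With a constant representative only [j = ord0] gives a condition; the other sums are empty. *)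
have sum0E (x : I -> int) j :
    \sum_(i | ord0 == j) x i = if ord0 == j then \sum_i x i else 0.
  by case: eqP => _ //; rewrite big_pred0.
apply/seteqP; split=> g.
  move=> [w [t [/weyl_group_linear[p wp] /coroot_lattice_sum0[x -> x0] ->]]].
  exists p, x; split=> //; last by move=> j; rewrite sum0E x0 if_same.
  apply: acts_as_ext (acts_as_mul (acts_as_translation x) wp) (mul1g _) _ => i.
  by rewrite addr0.
move=> [p [x [gp _ x0]]].
exists (affine_perm p (fun=> 0)), (\row_i (x i)%:~R); split.
- apply: (@perm_generation (fun=> ord0) _ p) (acts_as_affine_perm p _) => //.
    exact: subgroup_generated.
  move=> i j ij _; apply: sub_gen_smallest; exists (e i - e j) => //.
  by exists i, j.
- apply: (@lattice_generation (fun=> ord0)) => // [|i j ij _].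
    split=> [A [[A0 _] _] //|u v Lu Lv A cA].
    by have [[_ AB] _] := cA; apply: AB; [exact: Lu | exact: Lv].
  apply: sub_gen_smallest; exists (e i - e j); last exact: coroot_root.
  by exists i, j.
apply: acts_as_inj gp (acts_as_ext (acts_as_mul (acts_as_translation x)
         (acts_as_affine_perm p (fun=> 0))) (mul1g _) (frefl _)) _ => i.
by rewrite addr0.
Qed.

(** * The reflection subgroup obtained by removing a node *)

Section ParabolicRoots.
Variable k : nat.

(** With coordinates counted from 0, [fundamental_root k] is e_(k-1) - e_k, so removing it cuts the
    coordinates between k - 1 and k. *)
Definition block_roots : set V :=
  [set b | exists i j, [/\ i != j, (i < k)%N = (j < k)%N & b = e i - e j]].

Lemma roots_withoutE : @roots_without R n k = block_roots.
Proof.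
apply/seteqP; split.
  apply: smallest_sub.
    move=> _ _ [i [j [ij kij ->]]] [a [b [ab kab ->]]].
    exists (tperm i j a), (tperm i j b); split.
    - by rewrite (inj_eq perm_inj).
    - have tk c : (tperm i j c < k)%N = (c < k)%N by case: tpermP => // ->.
      by rewrite !tk.
    - exact: reflection_root.
  move=> _ [i [/andP[i_gt0 i_le] /eqP ik] <-].
  have i1 : (i.-1 < n.+1)%N by rewrite (leq_ltn_trans (leq_pred _)).
  exists (Ordinal i1), (Ordinal (i_le : (i < n.+1)%N)); split=> //=.
    by apply/eqP => /(congr1 val) /=; lia.
  by lia.
pose X := @roots_without R n k.
have X_closed b c : X b -> X c -> X (affine_reflection b 0 c).
  move=> Xb Xc A cA; have [Arefl _] := cA.
  by apply: Arefl; [exact: Xb | exact: Xc].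
(* Induction on the height [j - i]: the fundamental root at [j] reflects e_i - e_(j-1) to e_i -
   e_j. *)
have X_lt m : forall i j, (j = i + m.+1 :> nat)%N -> (i < k)%N = (j < k)%N ->
    X (e i - e j).
  elim: m => [|m IHm] i j ji kij.
    apply: sub_gen_smallest; exists j; last by rewrite /fundamental_root ji addn1.
    have := ltn_ord j; split; first by lia.
    by apply/eqP; lia.
  have j1 : (i + m.+1 < n.+1)%N by have := ltn_ord j; lia.
  pose a := Ordinal j1; have aj : a != j by apply/eqP => /(congr1 val) /=; lia.
  have ia : i != a by apply/eqP => /(congr1 val) /=; lia.
  have ij : i != j by apply/eqP => /(congr1 val) /=; lia.
  suff -> : e i - e j = affine_reflection (e a - e j) 0 (e i - e a).
    apply: X_closed; last by apply: IHm => //=; lia.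
    apply: sub_gen_smallest; exists j; last first.
      by rewrite /fundamental_root ji addnS.
    have := ltn_ord j; split; first by lia.
    by apply/eqP; lia.
  by rewrite reflection_root // tpermL tpermD // eq_sym.
move=> _ [i [j [ij kij ->]]].
have [ltij|] := ltnP i j; first by apply: (X_lt (j - i.+1)%N) => //; lia.
rewrite leq_eqVlt eq_sym val_eqE (negPf ij) /= => ltji.
have ji : j != i by rewrite eq_sym.
(* A negative root is the reflection of a positive root in itself. *)
suff -> : e i - e j = affine_reflection (e j - e i) 0 (e j - e i).
  by apply: X_closed; apply: (X_lt (i - j.+1)%N) => //; lia.
by rewrite reflection_root // tpermL tpermR.
Qed.

(** For [0 < k <= n] each block is represented by its least index. *)
Definition block_rep (i : I) : I := if (i < k)%N then ord0 else inord k.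

Hypothesis k_bounds : (0 < k <= n)%N.

Lemma block_rep_eq i j : (block_rep i == block_rep j) = ((i < k)%N == (j < k)%N).
Proof.
have [k0 kn] := andP k_bounds.
have rep_neq : ord0 != inord k :> I by rewrite -val_eqE /= inordK // neq_ltn k0.
rewrite /block_rep; do 2!case: ifP => _; rewrite ?eqxx ?(negPf rep_neq) //.
by rewrite eq_sym (negPf rep_neq).
Qed.

Lemma block_repK i : block_rep (block_rep i) = block_rep i.
Proof.
have [k0 kn] := andP k_bounds; apply/eqP; rewrite block_rep_eq /block_rep.
by case: ifP => _ /=; rewrite ?k0 // inordK // ltnn.
Qed.

Lemma reflection_subgroupE :
  reflection_subgroup R n k = block_affine_group block_rep.
Proof.
apply/seteqP; split.
  apply: smallest_sub; first exact: subgroup_block_affine_group.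
  move=> _ [b [m [+ ->]]]; rewrite roots_withoutE => -[i [j [ij kij ->]]].
  apply: reflection_block_affine_group => //.
  by apply/eqP; rewrite block_rep_eq kij.
apply: block_affine_group_generated; first exact: block_repK.
  exact: subgroup_generated.
move=> i j m ij /eqP; rewrite block_rep_eq => /eqP kij.
apply: sub_gen_smallest; exists (e i - e j), m; split=> //.
by rewrite roots_withoutE; exists i, j.
Qed.

End ParabolicRoots.
End AffinePermutations.

(** * Double cosets of block-preserving affine permutations *)

Lemma perm_of_fibers (m : nat) (T : eqType) (f f' : 'I_m -> T) :
    (forall t, #|[set i | f i == t]%SET| = #|[set i | f' i == t]%SET|) ->
  exists q : 'S_m, forall i, f (q i) = f' i.
Proof.
move=> eq_fib.
have countE (h : 'I_m -> T) t :
    count_mem t [tuple h i | i < m] = #|[set i | h i == t]%SET|.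
  by rewrite /= count_map cardE -size_filter enumT /enum_mem; congr size;
    apply: eq_filter => i; rewrite !finset.inE.
(* Equal fibre sizes make the two value tuples rearrangements of each other. *)
have /tuple_permP[q eq_q] :
    perm_eq [tuple f' i | i < m] [tuple f i | i < m].
  by apply/allP => t _ /=; rewrite !countE eq_fib.
exists q => i; move: eq_q => /val_inj/(congr1 (fun s => tnth s i)).
by rewrite !tnth_mktuple.
Qed.

Section DoubleCosets.
Local Open Scope ring_scope.
Variables (R : realType) (n k : nat).
Local Notation V := 'rV[R]_n.+1.
Local Notation I := 'I_n.+1.
Implicit Types (g h a b : selfbij V) (p q : 'S_n.+1) (x y : I -> int).

(* The pairs (p, x) for which p preserves (e = false) or swaps (e = true) the two
   blocks and the sum of x over the first block is s. *)
Definition block_coset (e : bool) (s : int) : set (selfbij V) :=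
  [set g | exists p x, [/\ acts_as g p x, forall i, (p i < k)%N = e (+) (i < k)%N,
                           \sum_(i : I | (i < k)%N) x i = s & \sum_i x i = 0]].

(** A swap turns the sum over the first block into the sum over the second, which is its negative
    because the total is 0. *)
Lemma sum_block_perm (e : bool) p x :
    (forall i, (p i < k)%N = e (+) (i < k)%N) -> \sum_i x i = 0 ->
  \sum_(i : I | (i < k)%N) x (p i) = (-1) ^+ e * \sum_(i : I | (i < k)%N) x i.
Proof.
move=> pe x0; transitivity (\sum_(i : I | e (+) (i < k)%N) x i).
  rewrite [RHS](reindex_inj (@perm_inj _ p)) /=.
  by apply: eq_bigl => i; rewrite pe addKb.
case: (e) => /=; last by rewrite mul1r.
apply/eqP; rewrite expr1 mulN1r -addr_eq0 addrC -[X in _ == X]x0.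
by rewrite [X in _ == X](bigID (fun i : I => (i < k)%N)).
Qed.

Lemma sum_perm p x : \sum_i x (p i) = \sum_i x i.
Proof. by rewrite [RHS](reindex_inj (@perm_inj _ p)). Qed.

(** The pairs [(e, s)] compose as in the infinite dihedral group. *)
Lemma block_coset_mul e s g d t h : block_coset e s g -> block_coset d t h ->
  block_coset (e (+) d) (s + (-1) ^+ e * t) (g * h)%g.
Proof.
move=> [p [x [gp pe <- x0]]] [q [y [hq qd <- y0]]].
exists (p * q)%g, (fun i => x i + y (p i)); split.
- exact: acts_as_mul.
- by move=> i; rewrite permM qd pe addbA [d (+) e]addbC.
- by rewrite big_split /= (sum_block_perm pe).
- by rewrite big_split /= x0 sum_perm y0.
Qed.

Lemma block_coset_inv e s g : block_coset e s g ->
  block_coset e (- (-1) ^+ e * s) g^-1%g.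
Proof.
move=> [p [x [gp pe <- x0]]].
have peV i : (p^-1%g i < k)%N = e (+) (i < k)%N.
  by rewrite -[in RHS](permKV p i) pe addKb.
exists p^-1%g, (fun i => - x (p^-1%g i)); split=> //.
- exact: acts_as_inv.
- by rewrite sumrN (sum_block_perm peV) // mulNr.
- by rewrite sumrN sum_perm x0 oppr0.
Qed.

Lemma block_coset1 : block_coset false 0 1%g.
Proof.
exists 1%g, (fun=> 0); split; first exact: acts_as_one.
- by move=> i; rewrite perm1.
- by rewrite big1.
- by rewrite big1.
Qed.

(** A complete invariant of the double coset of [p] under block-preserving permutations. *)
Definition overlap p := #|[set i : I | (i < k)%N && (p i < k)%N]%SET|.

Lemma overlapV p : overlap p^-1%g = overlap p.
Proof.
rewrite /overlap -!sum1_card (reindex_inj (@perm_inj _ p)) /=.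
by apply: eq_bigl => i; rewrite !finset.inE permK andbC.
Qed.

Lemma overlapM p q : (forall i : I, (q i < k)%N = (i < k)%N) ->
  overlap (q * p)%g = overlap p.
Proof.
move=> qk; rewrite /overlap -!sum1_card [RHS](reindex_inj (@perm_inj _ q)) /=.
by apply: eq_bigl => i; rewrite !finset.inE permM qk.
Qed.

(** The size of [B u] does not depend on [u], so the overlap fixes the sizes of all four cells cut
    out by [A] and [B u]; cells of equal size can be matched. *)
Lemma overlap_perm p p' : overlap p = overlap p' ->
  exists2 q : 'S_n.+1, forall i : I, (q i < k)%N = (i < k)%N &
    forall i : I, (p (q i) < k)%N = (p' i < k)%N.
Proof.
move=> eq_pp'.
have [|q qE] := @perm_of_fibers _ _ (fun i => ((i < k)%N, (p i < k)%N))
                                    (fun i => ((i < k)%N, (p' i < k)%N)).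
  pose A := [set i : I | (i < k)%N]%SET.
  pose B (u : 'S_n.+1) := [set i : I | (u i < k)%N]%SET.
  have cardB u : #|B u| = #|A|.
    rewrite -!sum1_card [RHS](reindex_inj (@perm_inj _ u)) /=.
    by apply: eq_bigl => i; rewrite !finset.inE.
  have AB : #|A :&: B p| = #|A :&: B p'|.
    move: eq_pp'; rewrite /overlap; congr (_ = _);
      by apply: eq_card => i; rewrite !finset.inE.
  have fibE (u : 'S_n.+1) t : #|[set i : I | ((i < k)%N, (u i < k)%N) == t]%SET| =
      #|(if t.1 then A else ~: A) :&: (if t.2 then B u else ~: B u)|.
    by case: t => [[] []]; apply: eq_card => i; rewrite !finset.inE xpair_eqE /=;
       do 2!case: (_ < k)%N.
  move=> t; rewrite !fibE.
  have cardD (X Y : {set I}) : #|X :&: ~: Y| = (#|X| - #|X :&: Y|)%N.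
    by rewrite -finset.setDE cardsD.
  have AcB : #|~: A :&: B p| = #|~: A :&: B p'|.
    rewrite ![~: A :&: _]finset.setIC !cardD ![B _ :&: A]finset.setIC AB.
    by rewrite !cardB.
  by case: t => [[] []] /=; rewrite ?AB ?AcB // !cardD ?AB ?AcB.
exists q => i; first by have [] := qE i.
by have [_] := qE i.
Qed.

Definition straddles p := exists i j : I,
  [/\ (i < k)%N, ~~ (j < k)%N & (p i < k)%N = (p j < k)%N].

(** Equal overlaps match the linear parts; straddling then lets the translations be matched. *)
Lemma double_coset g g' p p' x x' :
    acts_as g p x -> acts_as g' p' x' -> \sum_i x i = 0 -> \sum_i x' i = 0 ->
    overlap p = overlap p' -> straddles p ->
  exists a b,
    [/\ block_coset false 0 a, block_coset false 0 b & g' = (a * g * b)%g].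
Proof.
move=> gp gp' x0 x'0 /overlap_perm[q qk pqk] [i0 [j0 [i0k j0k pij]]].
pose m := \sum_(i : I | (i < k)%N) x' i - \sum_(i : I | (i < k)%N) x i.
pose y (i : I) : int := m * ((i == p i0)%:R - (i == p j0)%:R).
pose y' (i : I) : int := x' i - x (q i) - y (p (q i)).
have yk : \sum_(i : I | (i < k)%N) y i = 0.
  by rewrite -mulr_sumr sumrB !sum_delta pij subrr mulr0.
have y0 : \sum_i y i = 0 by rewrite -mulr_sumr sumrB !sum_delta subrr mulr0.
have ypk : \sum_(i : I | (i < k)%N) y (p i) = m.
  rewrite -mulr_sumr; under eq_bigr do rewrite !(inj_eq perm_inj).
  by rewrite sumrB !sum_delta i0k (negPf j0k) subr0 mulr1.
(* [q'] is forced by [q * p * q' = p']; it preserves the blocks since [q * p] and [p'] have the same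
   block pattern. *)
pose q' := (p^-1 * q^-1 * p')%g.
have pqq' : (q * p * q')%g = p' by rewrite /q' !mulgA mulgK mulgV mul1g.
have q'k (j : I) : (q' j < k)%N = (j < k)%N.
  have [c ->] : exists c : I, j = p (q c).
    by exists (q^-1%g (p^-1%g j)); rewrite !permKV.
  by rewrite pqk -!permM mulgA pqq'.
(* The linear part of g maps e_(p i0) - e_(p j0), a root inside one block, to
   e_i0 - e_j0, which straddles the blocks; so y on the right of g changes the sum
   over the first block by m, and what remains is corrected by y' on the left. *)
exists (affine_perm R q y'), (affine_perm R q' y); split.
- exists q, y'; split=> //; first exact: acts_as_affine_perm.
    rewrite !sumrB (@sum_block_perm false) // (@sum_block_perm false q (y \o p)) //.
      by rewrite /= !mul1r ypk /m; ring.
    by rewrite sum_perm.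
  by rewrite !sumrB sum_perm (sum_perm q (y \o p)) /= sum_perm x0 x'0 y0.
- by exists q', y; split=> //; exact: acts_as_affine_perm.
apply: acts_as_inj gp' (acts_as_ext (acts_as_mul (acts_as_mul
  (acts_as_affine_perm q y') gp) (acts_as_affine_perm q' y)) pqq' (frefl _)) _ => i.
by rewrite /y' permM; ring.
Qed.

(** Indices from different blocks then have images in different blocks. Comparing every index with 0
    or with [z], the index [k], fixes the whole pattern of [p]. *)
Lemma straddlesN p : (k <= n)%N -> (0 < k)%N -> ~ straddles p ->
  exists e : bool, forall i : I, (p i < k)%N = e (+) (i < k)%N.
Proof.
move=> kn k0 nstr; pose z : I := inord k.
have zk : ~~ (z < k)%N by rewrite /z inordK // ltnn.
have oppk (i j : I) : (i < k)%N -> ~~ (j < k)%N -> (p i < k)%N = ~~ (p j < k)%N.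
  move=> ik jk; have [pij|] := eqVneq (p i < k)%N (p j < k)%N.
    by exfalso; apply: nstr; exists i, j.
  by case: (p i < k)%N; case: (p j < k)%N.
exists (p z < k)%N => i; have [ik|ik] := boolP (i < k)%N.
  by rewrite addbT; exact: oppk.
by rewrite addbF; apply: negb_inj; rewrite -!(oppk ord0).
Qed.

Hypothesis k_bounds : (0 < k <= n)%N.
Let k0 : (0 < k)%N. Proof. by case/andP: k_bounds. Qed.
Let kn : (k <= n)%N. Proof. by case/andP: k_bounds. Qed.

Lemma affine_weyl_groupP g : affine_weyl_group R n g <->
  exists p x, acts_as g p x /\ \sum_i x i = 0.
Proof.
rewrite affine_weyl_groupE; split=> [[p [x [gp _ x0]]]|[p [x [gp x0]]]].
  exists p, x; split=> //; rewrite -[RHS](x0 ord0).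
  by apply: eq_bigl => i; rewrite eqxx.
exists p, x; split=> // j; case: (eqVneq ord0 j) => _ //.
by rewrite big_pred0.
Qed.

Lemma subgroup_affine_weyl_group : subgroup (affine_weyl_group R n).
Proof. by rewrite affine_weyl_groupE; exact: subgroup_block_affine_group. Qed.

(** Both block sums vanish exactly when the first block sum and the total do. *)
Lemma reflection_subgroup_coset : reflection_subgroup R n k = block_coset false 0.
Proof.
rewrite reflection_subgroupE //; apply/seteqP; split=> g [p [x [gp pk]]].
  move=> x0; exists p, x; split=> //.
  - by move=> i; have /eqP := pk i; rewrite block_rep_eq // => /eqP.
  - rewrite -[RHS](x0 (block_rep k ord0)); apply: eq_bigl => i.
    by rewrite block_rep_eq //= k0 eqb_id.
  - rewrite (partition_big (block_rep k) xpredT) //= big1 // => j _; exact: x0.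
move=> xk x0; exists p, x; split=> // [i|j].
  by apply/eqP; rewrite block_rep_eq // pk.
case: (pselect (exists i, j = block_rep k i)) => [[i ->]|nj]; last first.
  by rewrite big_pred0 // => i; apply/eqP => ij; apply: nj; exists i.
under eq_bigl do rewrite block_rep_eq //.
case: (i < k)%N; first by rewrite -[RHS]xk; apply: eq_bigl => a; rewrite eqb_id.
rewrite (bigID (fun i : I => (i < k)%N)) /= xk add0r in x0.
by rewrite -[RHS]x0; apply: eq_bigl => a; rewrite eqbF_neg.
Qed.

Lemma block_coset_sub e s : block_coset e s `<=` affine_weyl_group R n.
Proof. by move=> g [p [x [gp _ _ x0]]]; apply/affine_weyl_groupP; exists p, x. Qed.

(** The permutation maps the first block bijectively onto its complement, so [k = n + 1 - k]. *)
Lemma block_coset_swap s g : block_coset true s g -> (2 * k = n + 1)%N.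
Proof.
move=> [p [_ [_ pk _ _]]].
have kI : #|[set i : I | (i < k)%N]%SET| = k.
  rewrite -sum1_card -[RHS](card_ord k) -[RHS]sum1_card.
  rewrite (big_ord_widen n.+1 (fun=> 1%N)); last exact: leqW.
  by apply: eq_bigl => i; rewrite !finset.inE.
have : #|[set i : I | (i < k)%N]%SET| = #|(~: [set i : I | (i < k)%N])%SET|.
  rewrite -!sum1_card [RHS](reindex_inj (@perm_inj _ p)) /=.
  by apply: eq_bigl => i; rewrite !finset.inE pk negbK.
by have := cardsC [set i : I | (i < k)%N]%SET; rewrite kI card_ord; lia.
Qed.

(** * The case of blocks of different sizes *)

Lemma proto_gelfand_reflection_subgroup : (2 * k)%N <> (n + 1)%N ->
  proto_gelfand (affine_weyl_group R n) (reflection_subgroup R n k).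
Proof.
move=> nk; rewrite reflection_subgroup_coset.
(* [K] is the stabiliser of the first block; [s] embeds its quotient by H_k into the integers. *)
pose K := [set g | exists s, block_coset false s g].
have mulS s t g h : block_coset false s g -> block_coset false t h ->
    block_coset false (s + t) (g * h)%g.
  by move=> gs ht; have := block_coset_mul gs ht; rewrite expr0 mul1r.
have invS s g : block_coset false s g -> block_coset false (- s) g^-1%g.
  by move=> gs; have := block_coset_inv gs; rewrite expr0 mulN1r.
(* A permutation that does not straddle preserves or swaps the blocks: the former puts [g] in [K],
   the latter forces [2 * k = n + 1]. *)
have str g p x : acts_as g p x -> \sum_i x i = 0 -> ~ K g -> straddles p.
  move=> gp x0 nKg; apply: contrapT => /straddlesN -/(_ kn k0)[[] pe].
    apply: nk; apply: (@block_coset_swap (\sum_(i : I | (i < k)%N) x i) g).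
    by exists p, x.
  by apply: nKg; exists (\sum_(i : I | (i < k)%N) x i), p, x.
apply: (@proto_gelfand_criterion _ _ K).
- exact: subgroup_affine_weyl_group.
- split; first by exists 0; exact: block_coset1.
  + by move=> g h [s gs] [t ht]; exists (s + t); exact: mulS.
  + by move=> g [s gs]; exists (- s); exact: invS.
- by rewrite -reflection_subgroup_coset; exact: subgroup_generated.
- by move=> g Hg; exists 0.
- by move=> g [s]; exact: block_coset_sub.
- move=> g h [s gs] [t ht].
  (* The value of [s] at the commutator is [- (t + s) + (s + t)]. *)
  have := mulS _ _ _ _ (invS _ _ (mulS _ _ _ _ ht gs)) (mulS _ _ _ _ gs ht).
  by rewrite [t + s]addrC addNr.
- move=> g /affine_weyl_groupP[p [x [gp x0]]] nKg.
  apply: (double_coset gp (acts_as_inv gp) x0 _ _ (str _ _ _ gp x0 nKg)).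
    by rewrite sumrN sum_perm x0 oppr0.
  by rewrite overlapV.
- move=> g h /affine_weyl_groupP[p [x [gp x0]]] nKg [s [q [y [hq qk _ y0]]]].
  apply: (double_coset gp (acts_as_mul hq gp) x0 _ _ (str _ _ _ gp x0 nKg)).
    by rewrite big_split /= sum_perm x0 y0.
  by rewrite overlapM.
Qed.

(** * The case of blocks of equal size *)

Hypothesis k_half : (2 * k = n + 1)%N.

Definition extended_reflection_subgroup : set (selfbij V) :=
  [set g | exists e, block_coset e 0 g].

Local Notation H := (reflection_subgroup R n k).
Local Notation P := extended_reflection_subgroup.

(** The reversal of the coordinates, which exchanges two blocks of equal size and fixes the
    origin. *)
Definition block_swap : selfbij V :=
  affine_perm R (perm (@rev_ord_inj n.+1)) (fun=> 0).

Lemma block_swap_coset : block_coset true 0 block_swap.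
Proof.
exists (perm (@rev_ord_inj n.+1)), (fun=> 0); split.
- exact: acts_as_affine_perm.
- by move=> i; rewrite permE /=; have := ltn_ord i; lia.
- by rewrite big1.
- by rewrite big1.
Qed.

Lemma reflection_subgroup_sub_extended : H `<=` P.
Proof. by rewrite reflection_subgroup_coset => g Hg; exists false. Qed.

Lemma extended_sub_affine_weyl_group : P `<=` affine_weyl_group R n.
Proof. by move=> g [e]; exact: block_coset_sub. Qed.

Lemma subgroup_extended : subgroup P.
Proof.
split; first by exists false; exact: block_coset1.
- move=> g h [e ge] [d hd]; exists (e (+) d).
  by have := block_coset_mul ge hd; rewrite mulr0 addr0.
- by move=> g [e ge]; exists e; have := block_coset_inv ge; rewrite mulr0.
Qed.

Lemma has_index_extended : has_index P H 2.
Proof.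
have sH : subgroup H by exact: subgroup_generated.
have [_ HM HV] := sH; have HE := reflection_subgroup_coset.
(* The two cosets are [H] and its translate by [block_swap]. *)
pose f (i : nat) : set (selfbij V) :=
  if i == 0%N then H else [set (block_swap * h)%g | h in H].
have w_coset := block_swap_coset.
rewrite /has_index; have -> : left_cosets P H = f @` `I_2.
  apply/seteqP; split=> [_ [g [[] ge] <-]|_ [[|[|i]] // _ <-]].
  - exists 1%N => //; rewrite /f /=.
    have wg : H (block_swap^-1 * g)%g.
      rewrite HE; have := block_coset_mul (block_coset_inv w_coset) ge.
      by rewrite /= !mulr0 addr0.
    apply/seteqP; split=> _ [h Hh <-].
      exists (g^-1 * block_swap * h)%g; last by rewrite !mulgA mulgV mul1g.
      by apply: (HM) => //; have := HV _ wg; rewrite invMg invgK.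
    exists (block_swap^-1 * g * h)%g; last by rewrite !mulgA mulgV mul1g.
    exact: HM.
  - have Hg : H g by rewrite HE.
    exists 0%N => //; rewrite /f /=; apply/seteqP; split=> [h Hh|_ [h Hh <-]].
      by exists (g^-1 * h)%g; [apply: (HM) => //; exact: HV | rewrite mulKVg].
    exact: HM.
  - exists 1%g; first by exists false; exact: block_coset1.
    apply/seteqP; split=> [_ [h Hh <-]|h Hh]; first by rewrite mul1g.
    by exists h => //; rewrite mul1g.
  - by exists block_swap => //; exists true.
suff Hw : ~ H block_swap.
  have HwH : H <> [set (block_swap * h)%g | h in H].
    move=> HwH; apply: Hw; rewrite HwH.
    by exists 1%g; [case: sH | rewrite mulg1].
  apply: inj_card_eq => i j /set_mem /= i2 /set_mem /= j2; rewrite /f.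
  case: i i2 => [|[|//]] _; case: j j2 => [|[|//]] _ //=.
  by move=> wHH; case: HwH.
rewrite HE => -[p [x [wp pk _ _]]]; have [q [y [wq qk _ _]]] := w_coset.
by have := pk ord0; rewrite (acts_as_perm_unique wp wq) qk; case: (_ < _)%N.
Qed.

(** The criterion is applied with [K] and [A] both equal to [P], so only closure under inversion has
    content. *)
Lemma proto_gelfand_extended : proto_gelfand (affine_weyl_group R n) P.
Proof.
have [P1 PM PV] := subgroup_extended.
apply: (@proto_gelfand_criterion _ _ P).
- exact: subgroup_affine_weyl_group.
- exact: subgroup_extended.
- exact: subgroup_extended.
- by [].
- exact: extended_sub_affine_weyl_group.
- by move=> g h Pg Ph; apply: (PM); [apply: PV; exact: PM | exact: PM].
- move=> g Gg _; have [p [x [gp x0]]] := (affine_weyl_groupP g).1 Gg.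
  have [p_str|/straddlesN -/(_ kn k0)[e pe]] := pselect (straddles p).
    have [||a [b [Ha Hb gV]]] := double_coset gp (acts_as_inv gp) x0 _ _ p_str.
    + by rewrite sumrN sum_perm x0 oppr0.
    + by rewrite overlapV.
    + by exists a, b; split=> //; exists false.
  pose s := \sum_(i : I | (i < k)%N) x i.
  have ge : block_coset e s g by exists p, x.
  have geV := block_coset_inv ge.
  case: e pe ge geV => _ ge geV.
    (* A block-swapping [g] acts as a reflection in the dihedral quotient, so its square lies in
       H_k. *)
    exists 1%g, (g^-1 * g^-1)%g; split=> //; last by rewrite mul1g mulKVg.
    exists false; have := block_coset_mul geV geV; rewrite expr1 /= opprK !mul1r.
    by rewrite mulN1r subrr.
  (* For block-preserving [g], conjugation by [block_swap] inverts the class of [g] modulo H_k;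
     hence the left factor below has [s = - s0 + s0 = 0], where [s0] is the value for [g]. *)
  have wV := block_coset_inv block_swap_coset.
  exists (g^-1 * block_swap^-1 * g^-1)%g, block_swap; split;
    last by rewrite mulgKV mulgKV.
    exists true; have := block_coset_mul (block_coset_mul geV wV) geV.
    by rewrite /= !expr0 expr1 !mulr0 !mulN1r !addr0 opprK addNr.
  by exists true; exact: block_swap_coset.
- move=> g h _ _ Ph; exists h, 1%g; split=> //; by rewrite mulg1.
Qed.

End DoubleCosets.

Theorem corollary1p3 (R : realType) (n k : nat) (hk : 1 <= k <= n) :
  (2 * k <> n + 1 ->
     proto_gelfand (affine_weyl_group R n) (reflection_subgroup R n k)) /\
  (2 * k = n + 1 ->
     exists K : set (selfbij 'rV[R]_n.+1),
       [/\ subgroup K,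
           reflection_subgroup R n k `<=` K,
           K `<=` affine_weyl_group R n,
           has_index K (reflection_subgroup R n k) 2 &
           proto_gelfand (affine_weyl_group R n) K]).
Proof.
split=> nk; first exact: proto_gelfand_reflection_subgroup.
exists (@extended_reflection_subgroup R n k); split.
- exact: subgroup_extended.
- exact: reflection_subgroup_sub_extended.
- exact: extended_sub_affine_weyl_group.
- exact: has_index_extended.
- exact: proto_gelfand_extended.
Qed.
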